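(* Let $\alpha\in(0,1)$. There exists $C(\alpha)>0$ such that for every $u\in L^\infty([0,1],C^\alpha(\mathbb T^2))$, all $\kappa\in(0,1)$, $x\in\mathbb T^2$ and $t\in[0,1]$, if $X^\kappa_t$ is a solution to $$dX^\kappa_t=u(t,X^\kappa_t)\,dt+\sqrt{2\kappa}\,dw_t,\qquad X^\kappa_0=x,$$ with $w_t$ a standard Brownian motion in $\mathbb R^2$, then $$\mathrm{Var}(X^\kappa_t)\le C\Big(\kappa t+\big(\|u\|_{L^\infty([0,1],C^\alpha(\mathbb T^2))}\,t\big)^{\frac2{1-\alpha}}\Big).$$
   Context: $\mathbb T^2$ is $[0,\sqrt2]\times[0,1]$ with periodic boundary. For a $\mathbb T^2$-valued random variable $X$ with law $\mu$, $\mathrm{Var}(X):=\inf_{a\in\mathbb T^2}\int_{\mathbb T^2}|x-a|^2\,d\mu(x)$, where $|x-y|$ is the distance in $\mathbb T^2$. The field $u$ takes values in $\mathbb R^2$. *)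

(* Defs.v *)
From HB Require Import structures.
From mathcomp Require Import all_boot all_order all_algebra generic_quotient.
From mathcomp Require Import all_classical all_reals all_analysis.

Set Implicit Arguments.
Unset Strict Implicit.
Unset Printing Implicit Defensive.

Import Order.TTheory GRing.Theory Num.Theory numFieldNormedType.Exports.

Local Open Scope classical_set_scope.
Local Open Scope ring_scope.
Local Open Scope quotient_scope.

(* R^2 is R * R.  The library norm of a product is the max norm, so the
   Euclidean one is spelled out. *)
Definition enorm {R : realType} (v : R * R) : R :=
  Num.sqrt (v.1 ^+ 2 + v.2 ^+ 2).

(* The torus is the quotient of R^2 by the lattice (sqrt 2)Z x Z, i.e.
   [0, sqrt 2] x [0, 1] with opposite sides identified. *)
Definition lattice_eqv {R : realType} (a b : R * R) : bool :=
  `[< exists k l : int,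
        a.1 - b.1 = Num.sqrt 2 * k%:~R /\ a.2 - b.2 = l%:~R >].

Lemma lattice_eqv_refl (R : realType) : reflexive (@lattice_eqv R).
Proof. by move=> a; apply/asboolP; exists 0, 0; rewrite !subrr mulr0. Qed.

Lemma lattice_eqv_sym (R : realType) : symmetric (@lattice_eqv R).
Proof.
suff h (a b : R * R) : lattice_eqv a b -> lattice_eqv b a.
  by move=> a b; apply/idP/idP; exact: h.
move=> /asboolP[k [l [hk hl]]]; apply/asboolP; exists (- k), (- l).
by rewrite !mulrNz mulrN -hk -hl !opprB.
Qed.

Lemma lattice_eqv_trans (R : realType) : transitive (@lattice_eqv R).
Proof.
move=> b a c /asboolP[k [l [hk hl]]] /asboolP[k' [l' [hk' hl']]].
apply/asboolP; exists (k + k'), (l + l').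
by rewrite !intrD mulrDr -hk -hl -hk' -hl' !subrKA.
Qed.

Canonical lattice_equiv (R : realType) : equiv_rel (R * R)%type :=
  EquivRel (@lattice_eqv R) (@lattice_eqv_refl R) (@lattice_eqv_sym R)
    (@lattice_eqv_trans R).

Definition torus_quot (R : realType) := {eq_quot lattice_equiv R}.

Definition torus (R : realType) : Type := quotient_topology (torus_quot R).

HB.instance Definition _ (R : realType) :=
  Quotient.copy (torus R) (quotient_topology (torus_quot R)).
HB.instance Definition _ (R : realType) :=
  Topological.copy (torus R) (quotient_topology (torus_quot R)).
HB.instance Definition _ (R : realType) :=
  isPointed.Build (torus R) (\pi_(torus R) (0, 0)).
(* Borel sigma-algebra of the quotient topology *)
HB.instance Definition _ (R : realType) :=
  @isMeasurable.Build (sigma_display (@open (torus R))) (torus R)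
    <<s (@open (torus R)) >> (@sigma_algebra0 _ setT (@open (torus R)))
    (@sigma_algebraC _ (@open (torus R)))
    (@sigma_algebra_bigcup _ setT (@open (torus R))).

Definition torus_proj {R : realType} (a : R * R) : torus R := \pi_(torus R) a.

Lemma torus_proj_eq (R : realType) (a b : R * R) :
  (torus_proj a == torus_proj b) = lattice_eqv a b.
Proof.
have h c : torus_proj c = \pi_(torus_quot R) c by rewrite /torus_proj unlock.
by apply/eqP/idP; [rewrite !h => /eqmodP | move=> e; rewrite !h; apply/eqmodP].
Qed.

Definition torus_add {R : realType} (x : torus R) (v : R * R) : torus R :=
  torus_proj (repr x + v).

Lemma torus_add_proj (R : realType) (a v : R * R) :
  torus_add (torus_proj a) v = torus_proj (a + v).
Proof.
rewrite /torus_add; apply/eqP; rewrite torus_proj_eq.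
have : torus_proj (repr (torus_proj a)) = torus_proj a by rewrite /torus_proj reprK.
move=> /eqP; rewrite torus_proj_eq => /asboolP[k [l [h1 h2]]].
by apply/asboolP; exists k, l; rewrite /= -h1 -h2;
  split; rewrite opprD addrACA subrr addr0.
Qed.

Definition torus_dist {R : realType} (x y : torus R) : R :=
  inf [set enorm (a - b) | a in torus_proj @^-1` [set x]
                         & b in torus_proj @^-1` [set y]].

Definition variance_law {R : realType} (mu : set (torus R) -> \bar R) : \bar R :=
  ereal_inf [set \int[mu]_x ((torus_dist x a ^+ 2)%:E) | a in [set: torus R]]%E.

Definition torus_variance {R : realType} {d : measure_display}
    {Omega : measurableType d} (P : probability Omega R)
    (Y : Omega -> torus R) : \bar R :=
  variance_law (pushforward P Y).

(* ||f||_{C^alpha} = sup |f| + [f]_alpha, equal to +oo outside C^alpha *)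
Definition holder_norm {R : realType} (alpha : R) (f : torus R -> R * R) : \bar R :=
  (ereal_sup [set (enorm (f x))%:E | x in [set: torus R]] +
   ereal_sup [set (enorm (f p.1 - f p.2) / torus_dist p.1 p.2 `^ alpha)%:E
             | p in [set p : torus R * torus R | p.1 != p.2]])%E.

Definition Linf_holder_norm {R : realType} (alpha : R)
    (u : R -> torus R -> R * R) : \bar R :=
  Lnorm (mrestr (@lebesgue_measure R)
           (measurable_itv `[0%R, 1%R] : measurable (`[0%R, 1%R]%classic : set R)))
    +oo%E (fun t => holder_norm alpha (u t)).

Definition in_Linf_holder {R : realType} (alpha : R)
    (u : R -> torus R -> R * R) : Prop :=
  measurable_fun ((`[0%R, 1%R]%classic : set R) `*` [set: torus R])
    (fun p : R * torus R => u p.1 p.2) /\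
  (Linf_holder_norm alpha u < +oo)%E.

(* All processes are indexed by R, but only times in [0, 1] matter. *)
Section processes.
Context {R : realType} {d : measure_display} {Omega : measurableType d}.
Implicit Types (P : probability Omega R) (F : R -> set (set Omega)).

Definition is_filtration F : Prop :=
  (forall t : R, t \in `[0, 1] -> sigma_algebra setT (F t)) /\
  (forall t : R, t \in `[0, 1] -> F t `<=` measurable) /\
  (forall s t : R, s \in `[0, 1] -> t \in `[0, 1] -> s <= t -> F s `<=` F t).

Definition adapted {d' : measure_display} {S : measurableType d'} F
    (X : R -> Omega -> S) : Prop :=
  forall t : R, t \in `[0, 1] -> forall B : set S, measurable B -> F t (X t @^-1` B).

(* Standard Brownian motion in R^2 with respect to the filtration F; the
   second parameter of [normal_prob] is the standard deviation. *)
Definition is_brownian_motion P F (w : R -> Omega -> R * R) : Prop :=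
  [/\ adapted F w,
      {ae P, forall om, w 0 om = (0, 0)},
      {ae P, forall om, {within `[0, 1]%classic, continuous (fun t => w t om)}},
      (forall s t : R, s \in `[0, 1] -> t \in `[0, 1] -> s < t ->
       forall (G : set Omega) (B : set (R * R)), F s G -> measurable B ->
       P (G `&` (fun om => (w t om - w s om)%R) @^-1` B) = (P G * P ((fun om => (w t om - w s om)%R) @^-1` B))%E) &
      (forall s t : R, s \in `[0, 1] -> t \in `[0, 1] -> s < t ->
       forall B : set (R * R), measurable B ->
       P ((fun om => (w t om - w s om)%R) @^-1` B) =
       (normal_prob 0 (Num.sqrt (t - s)) \x normal_prob 0 (Num.sqrt (t - s)))%E B)].

Definition drift (u : R -> torus R -> R * R) (X : R -> Omega -> torus R)
    (t : R) (om : Omega) : R * R :=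
  ((\int[lebesgue_measure]_(s in `[0, t]) (u s (X s om)).1)%R,
   (\int[lebesgue_measure]_(s in `[0, t]) (u s (X s om)).2)%R).

(* X solves dX = u(t, X) dt + sqrt(2 kappa) dw, X_0 = x.  The noise being
   additive, the stochastic integral is sqrt(2 kappa) w_t. *)
Definition is_sde_solution P F (w : R -> Omega -> R * R)
    (u : R -> torus R -> R * R) (kappa : R) (x : torus R)
    (X : R -> Omega -> torus R) : Prop :=
  [/\ adapted F X,
      {ae P, forall om, X 0 om = x},
      {ae P, forall om, {within `[0, 1]%classic, continuous (fun t => X t om)}} &
      {ae P, forall om, forall t : R, t \in `[0, 1] ->
        X t om = torus_add x
          (drift u X t om + (Num.sqrt (2 * kappa) * (w t om).1,
                             Num.sqrt (2 * kappa) * (w t om).2))}].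
End processes.

(* Main.v *)
Require Import Defs.
From HB Require Import structures.
From mathcomp Require Import all_boot all_order all_algebra.
From mathcomp Require Import all_classical all_reals all_analysis.
From mathcomp Require Import measurable_realfun ess_sup_inf ring lra.

(** Compare two sample paths [X(om)] and [X(om0)] driven by the same drift.
    Their lifted difference is at most [D_s = 2 H(s) + a_s], where [H(s)] is the
    integral over [[0, s]] of [h_r = |u(r, X_r(om)) - u(r, X_r(om0))| <= N D_r^alpha]
    and [a_s] is the noise of both paths.  By Young's inequality
    [2 t h_r <= (1 - alpha) (2 N t)^(1/(1-alpha)) + alpha D_r], and integrating this
    over [[0, t]] bounds [D_t] by [(2 N t)^(1/(1-alpha))], [a_t] and the time average
    of [a]; no maximal inequality is needed.  The squared noise terms have mean
    [O(kappa t)] by Tonelli, so it suffices to take [X_t(om0)] as the centre of the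
    variance for one sample [om0] whose own noise does not exceed this mean much;
    this also avoids solving the deterministic equation. *)

Set Implicit Arguments.
Unset Strict Implicit.
Unset Printing Implicit Defensive.

Import Order.TTheory GRing.Theory Num.Theory numFieldNormedType.Exports.

Local Open Scope classical_set_scope.
Local Open Scope ring_scope.

(** * The torus *)

Lemma enorm_sqr (R : realType) (v : R * R) : enorm v ^+ 2 = v.1 ^+ 2 + v.2 ^+ 2.
Proof. by rewrite sqr_sqrtr// addr_ge0// sqr_ge0. Qed.

Lemma ler_norm_enorm (R : realType) (v : R * R) :
  `|v.1| <= enorm v /\ `|v.2| <= enorm v.
Proof.
by rewrite /enorm -!sqrtr_sqr; split; rewrite ler_sqrt ?addr_ge0 ?sqr_ge0//;
  rewrite ?lerDl ?lerDr sqr_ge0.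
Qed.

Lemma enorm_le (R : realType) (v : R * R) : enorm v <= `|v.1| + `|v.2|.
Proof.
rewrite -[leRHS]ger0_norm ?addr_ge0// -sqrtr_sqr /enorm ler_sqrt ?sqr_ge0//.
rewrite sqrrD !real_normK ?num_real// lerD2r lerDl.
by rewrite mulrn_wge0// mulr_ge0.
Qed.

Lemma torus_projK (R : realType) (x : torus R) : torus_proj (repr x) = x.
Proof. by rewrite /torus_proj reprK. Qed.

Lemma torus_dist_ge0 (R : realType) (x y : torus R) : 0 <= torus_dist x y.
Proof.
apply: lb_le_inf; last by move=> _ [a _ [b _ <-]]; exact: sqrtr_ge0.
by exists (enorm (repr x - repr y)), (repr x);
  [exact: torus_projK|exists (repr y) => //; exact: torus_projK].
Qed.

Lemma torus_dist_proj_le (R : realType) (a b : R * R) :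
  torus_dist (torus_proj a) (torus_proj b) <= enorm (a - b).
Proof.
apply: ge_inf; last by exists a => //; exists b.
by exists 0 => _ [c _ [d _ <-]]; exact: sqrtr_ge0.
Qed.

Lemma torus_dist_ltP (R : realType) (x y : torus R) (c : R) :
  torus_dist x y < c -> exists a b, [/\ torus_proj a = x, torus_proj b = y &
    enorm (a - b) < c].
Proof.
move=> /inf_lt[|_ [a ax [b bY <-]] abc].
  by exists (enorm (repr x - repr y)), (repr x);
    [exact: torus_projK|exists (repr y) => //; exact: torus_projK].
by exists a, b.
Qed.

Lemma intr_norm_lt1 (R : realType) (k : int) : `|k%:~R : R| < 1 -> k = 0.
Proof.
move=> k1; apply/eqP; apply: contraTT k1 => k0; rewrite -leNgt.
by rewrite norm_intr_ge1 ?intr_eq0//; exact: intr_int.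
Qed.

(* The lattice is discrete: differences of representatives shorter than 1/4
   all coincide, so the infimum defining a zero distance is attained. *)
Lemma torus_dist_gt0 (R : realType) (x y : torus R) :
  x != y -> 0 < torus_dist x y.
Proof.
move=> xy; rewrite lt_neqAle torus_dist_ge0 andbT eq_sym.
apply: contra_neq xy => xy0.
have [a [b [ax bY ab]]] : exists a b, [/\ torus_proj a = x, torus_proj b = y &
    enorm (a - b) < 4^-1].
  by apply: torus_dist_ltP; rewrite xy0.
have [ab0|ab0] := eqVneq (enorm (a - b)) 0.
  have [/= n1 n2] := ler_norm_enorm (a - b); move: n1 n2; rewrite ab0 !normr_le0.
  rewrite !subr_eq0 -ax -bY => /eqP h1 /eqP h2.
  by rewrite [a]surjective_pairing h1 h2 -surjective_pairing.
have [a' [b' [ax' bY' ab']]] : exists a' b', [/\ torus_proj a' = x, torus_proj b' = y &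
    enorm (a' - b') < enorm (a - b)].
  by apply: torus_dist_ltP; rewrite xy0 lt_neqAle eq_sym ab0 sqrtr_ge0.
have /eqP := etrans ax (esym ax'); rewrite torus_proj_eq => /asboolP[k [l [hk hl]]].
have /eqP := etrans bY (esym bY'); rewrite torus_proj_eq => /asboolP[k' [l' [hk' hl']]].
have [/= n1 n2] := ler_norm_enorm (a - b).
have [/= m1 m2] := ler_norm_enorm (a' - b').
have e1 : a.1 - b.1 - (a'.1 - b'.1) = Num.sqrt 2 * (k - k')%:~R.
  by rewrite intrB mulrBr -hk -hk'; ring.
have e2 : a.2 - b.2 - (a'.2 - b'.2) = (l - l')%:~R.
  by rewrite intrB -hl -hl'; ring.
(* Both periods are at least 1, while the coordinates of the two differences are below 1/4 in
   absolute value, so the lattice vector between these differences vanishes. *)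
have sq : 1 <= Num.sqrt 2 :> R by rewrite -[leLHS]sqrtr1 ler_sqrt//; lra.
have kk : k - k' = 0.
  apply: (@intr_norm_lt1 R).
  apply: le_lt_trans (_ : `|Num.sqrt 2 * (k - k')%:~R : R| < 1).
    by rewrite normrM ler_peMl// ger0_norm// sqrtr_ge0.
  by rewrite -e1; apply: le_lt_trans (ler_normB _ _) _; lra.
have ll : l - l' = 0.
  apply: (@intr_norm_lt1 R).
  by rewrite -e2; apply: le_lt_trans (ler_normB _ _) _; lra.
have : enorm (a - b) = enorm (a' - b').
  move: e1 e2; rewrite kk ll mulr0 => /eqP + /eqP; rewrite !subr_eq0 /enorm /=.
  by move=> /eqP -> /eqP ->.
by move: ab' => /[swap] ->; rewrite ltxx.
Qed.

Lemma continuous_enorm (R : realType) : continuous (@enorm R).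
Proof.
move=> v; apply: (@continuous_comp _ _ _ (fun v : R * R => v.1 ^+ 2 + v.2 ^+ 2)
  (@Num.sqrt R)); last exact: sqrt_continuous.
apply: cvgD; apply: (@continuous_comp _ _ _ _ (fun x : R => x ^+ 2));
  [exact: cvg_fst|exact: sqr_continuous|exact: cvg_snd|exact: sqr_continuous].
Qed.

(** Once [torus_proj] is unfolded, this is the definition of the quotient topology. *)
Lemma open_torus (R : realType) (A : set (torus R)) :
  open (torus_proj @^-1` A) -> open A.
Proof. by rewrite /torus_proj. Qed.

(** The preimage of a ball in the plane is the union of the Euclidean discs around all lifts of the
    centre. *)
Lemma open_torus_dist_lt (R : realType) (x : torus R) (c : R) :
  open [set y | torus_dist y x < c].
Proof.
apply: open_torus.
have -> : torus_proj @^-1` [set y | torus_dist y x < c] =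
    \bigcup_(p in torus_proj @^-1` [set x])
      (fun b : R * R => enorm (b - p)) @^-1` [set r | r < c].
  apply/seteqP; split => [b /= /torus_dist_ltP[b' [p' [bb' px bp]]]|b /= [p <- bp]];
    last exact: le_lt_trans (torus_dist_proj_le b p) bp.
  move/eqP: bb'; rewrite torus_proj_eq => /asboolP[k [l [hk hl]]].
  (* Translating the close pair [b'], [p'] by the lattice vector [b - b'] moves [b'] to the given
     lift [b] and [p'] to another lift of [x]. *)
  exists (p' - (b' - b)); last first.
    by rewrite /= opprB addrCA addrA subrK.
  rewrite /= -px; apply/eqP; rewrite torus_proj_eq; apply/asboolP.
  by exists (- k), (- l); rewrite !intrN mulrN -hk -hl /=; split; ring.
apply: bigcup_open => p _; apply: open_comp; last exact: open_lt.
move=> b _; apply: (@continuous_comp _ _ _ (fun b : R * R => b - p) (@enorm R));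
  last exact: continuous_enorm.
by apply: cvgB; [exact: cvg_id|exact: cvg_cst].
Qed.

Lemma measurable_torus_dist (R : realType) (x : torus R) :
  measurable_fun [set: torus R] (fun y => torus_dist y x).
Proof.
apply: (measurability _ (RGenInftyO.measurableE R)).
move=> _ [_ [c ->] <-]; rewrite setTI.
apply: sub_sigma_algebra.
rewrite (_ : _ @^-1` _ = [set y | torus_dist y x < c]).
  exact: (@open_torus_dist_lt _ x c).
by apply/seteqP; split => y /=; rewrite in_itv.
Qed.

Lemma torus_distxx (R : realType) (x : torus R) : torus_dist x x = 0.
Proof.
apply/eqP; rewrite eq_le torus_dist_ge0 andbT -(torus_projK x).
apply: le_trans (torus_dist_proj_le _ _) _.
by rewrite subrr /enorm/= expr0n/= addr0 sqrtr0.
Qed.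

(** * Brownian motion *)

(** The Radon-Nikodym derivative and the explicit [normal_pdf] have the same integral over every
    measurable set, so they agree almost everywhere. *)
Lemma ge0_integral_normal_prob (R : realType) (m s : R) (f : R -> \bar R) :
  measurable_fun [set: R] f -> (forall x, 0 <= f x)%E ->
  (\int[normal_prob m s]_x f x =
   \int[lebesgue_measure]_x (f x * (normal_pdf m s x)%:E))%E.
Proof.
move=> mf f0.
have dom := normal_prob_dominates m s.
rewrite -(Radon_Nikodym_SigmaFinite.change_of_variables dom)//.
apply: ae_eq_integral => //.
- apply: emeasurable_funM => //.
  exact: (measurable_int _ (Radon_Nikodym_SigmaFinite.f_integrable dom)).
- apply: emeasurable_funM => //; apply/measurable_EFinP.
  exact: measurable_normal_pdf.
- apply: ae_eqe_mul2l; apply: integral_ae_eq => //.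
  + exact: Radon_Nikodym_SigmaFinite.f_integrable.
  + apply/measurable_EFinP; exact: measurable_normal_pdf.
  + by move=> E _ mE; rewrite -Radon_Nikodym_SigmaFinite.f_integral.
Qed.

(* As [y <= exp y], [x^2 <= 4s^2 exp(x^2/4s^2)], and the exponential turns the
   N(0, s) density into a multiple of the N(0, sqrt 2 s) density. *)
Lemma normal_prob_sqr_le (R : realType) (s : R) : 0 < s ->
  (\int[normal_prob 0 s]_x (x ^+ 2)%:E <= (8 * s ^+ 2)%:E)%E.
Proof.
move=> s0; pose r := Num.sqrt 2 * s.
have s2 : 0 < Num.sqrt 2 :> R by rewrite sqrtr_gt0.
have r0 : 0 < r by rewrite mulr_gt0.
have rE : r ^+ 2 = 2 * s ^+ 2 by rewrite exprMn sqr_sqrtr.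
have peakE : normal_peak s = Num.sqrt 2 * normal_peak r.
  rewrite /normal_peak rE (_ : 2 * _ * _ *+ 2 = 2 * (s ^+ 2 * pi *+ 2)); last by ring.
  by rewrite (sqrtrM (s ^+ 2 * pi *+ 2))// invfM mulrA mulfV ?mul1r// gt_eqF.
rewrite ge0_integral_normal_prob; last 2 first.
- by apply/measurable_EFinP; exact: measurable_funX.
- by move=> x; rewrite lee_fin sqr_ge0.
have -> : (8 * s ^+ 2)%:E = (\int[lebesgue_measure]_x
    ((8 * s ^+ 2)%:E * (normal_pdf 0 r x)%:E))%E.
  rewrite ge0_integralZl//.
  - by rewrite integral_normal_pdf mule1.
  - apply/measurable_EFinP; exact: measurable_normal_pdf.
  - by move=> x _; rewrite lee_fin normal_pdf_ge0.
  - by rewrite lee_fin mulr_ge0// sqr_ge0.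
apply: ge0_le_integral => //.
- by move=> x _; rewrite -EFinM lee_fin mulr_ge0 ?sqr_ge0 ?normal_pdf_ge0.
- apply/measurable_EFinP; apply: measurable_funM; first exact: measurable_funX.
  exact: measurable_normal_pdf.
- apply/measurable_EFinP; apply: measurable_funM => //.
  exact: measurable_normal_pdf.
move=> x _; rewrite -!EFinM lee_fin !normal_pdfE ?gt_eqF// peakE /normal_fun subr0.
set y := x ^+ 2 / (4 * s ^+ 2).
have s2n0 : s ^+ 2 != 0 by rewrite expf_neq0// gt_eqF.
have -> : - x ^+ 2 / (s ^+ 2 *+ 2) = - y - y by rewrite /y; field; rewrite gt_eqF.
have -> : - x ^+ 2 / (r ^+ 2 *+ 2) = - y by rewrite rE /y; field; rewrite gt_eqF.
have -> : x ^+ 2 = 4 * s ^+ 2 * y by rewrite /y; field; rewrite gt_eqF.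
have peak0 := normal_peak_ge0 r.
(* The constant 8 is [4 * 2], where 2 bounds [Num.sqrt 2], the ratio of the two normalizing
   constants. *)
have sq2 : Num.sqrt 2 <= 2 :> R.
  by rewrite -[leRHS]ger0_norm// -sqrtr_sqr ler_sqrt// expr2; lra.
have yexp : y * expR (- y) <= 1.
  have := expR_ge1Dx y; rewrite expRN ler_pdivrMr ?expR_gt0// mul1r; lra.
have s22 : 0 < s ^+ 2 by rewrite exprn_gt0.
rewrite expRD; have e0 := expR_ge0 (- y); move: e0 yexp.
have y0 : 0 <= y by rewrite divr_ge0 ?sqr_ge0// mulr_ge0// sqr_ge0.
set e := expR _ => e0 ye.
rewrite [leLHS](_ : _ = 4 * s ^+ 2 * normal_peak r * e *
  (Num.sqrt 2 * (y * e))); last by ring.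
rewrite [leRHS](_ : _ = 4 * s ^+ 2 * normal_peak r * e * 2); last by ring.
apply: ler_wpM2l.
  by apply: mulr_ge0 => //; apply: mulr_ge0 => //; rewrite mulr_ge0// ltW.
by rewrite -[leRHS]mulr1; apply: ler_pM => //; exact: mulr_ge0.
Qed.

Lemma cvg_floor_div (R : realType) (s : R) :
  (fun n => (Num.floor (s * n.+1%:R))%:~R / n.+1%:R) @ \oo --> s.
Proof.
have n0 n : 0 < n.+1%:R :> R by [].
apply: (@squeeze_cvgr _ _ _ _ (fun n => s - harmonic n) (fun=> s)).
- near=> n; have /andP[h1 h2] := floor_itv (s * n.+1%:R).
  rewrite ler_pdivrMr// h1 andbT ler_pdivlMr// mulrBl /harmonic mulVf//.
  by rewrite lerBlDr ltW// -intrD1.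
- rewrite -[X in _ --> X]subr0; apply: cvgB; first exact: cvg_cst.
  exact: cvg_harmonic.
- exact: cvg_cst.
Unshelve. all: by end_near. Qed.

(** In time, [f] is sampled at the left ends of grid cells of length [1 / n.+1]. Each such step
    function pulls a measurable set back to a countable union of rectangles, and continuity in time
    makes the step functions converge pointwise to [f]. *)
Lemma measurable_fun_caratheodory (R : realType) d (T : measurableType d)
    (f : R -> T -> R) :
  (forall s, measurable_fun [set: T] (f s)) ->
  (forall x, continuous (f ^~ x)) ->
  measurable_fun [set: R * T] (fun p => f p.1 p.2).
Proof.
move=> mf cf.
pose h n (p : R * T) := f ((Num.floor (p.1 * n.+1%:R))%:~R / n.+1%:R) p.2.
apply: (@measurable_fun_cvg _ _ _ _ h); last first.
  move=> [s x] _; rewrite /h /=.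
  by apply: (cvg_comp _ (f ^~ x)); [exact: cvg_floor_div|exact: cf].
move=> n _ B mB; rewrite setTI.
have -> : h n @^-1` B = \bigcup_(i : int)
    (`[i%:~R / n.+1%:R, (i + 1)%:~R / n.+1%:R[%classic `*`
     (f (i%:~R / n.+1%:R) @^-1` B)).
  apply/seteqP; split => [[s x] Bsx|[s x] [i _ []]] /=.
    exists (Num.floor (s * n.+1%:R)) => //; split => //=.
    by rewrite in_itv/= ler_pdivrMr// ltr_pdivlMr// floor_itv.
  rewrite in_itv/= ler_pdivrMr// ltr_pdivlMr// => /floor_def.
  by rewrite /h /= => ->.
apply: countable_bigcupT_measurable; first exact: countableP.
by move=> i; apply: measurableX => //; rewrite -[X in measurable X]setTI; exact: mf.
Qed.

(** * Second moments of Brownian motion *)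

Section brownian_motion.
Context {R : realType} {d : measure_display} {Omega : measurableType d}.
Variables (P : probability Omega R) (F : R -> set (set Omega)).

Lemma measurable_fun_adapted {d' : measure_display} {S : measurableType d'}
    (Y : R -> Omega -> S) (t : R) : is_filtration F -> adapted F Y ->
  t \in `[0, 1] -> measurable_fun setT (Y t).
Proof.
move=> [_ [Fm _]] aY t01 _ B mB; rewrite setTI.
exact: (Fm _ t01 _ (aY _ t01 _ mB)).
Qed.

Lemma integral_sqr_normal_law_le (s : R) (Y : Omega -> R) : 0 < s ->
  measurable_fun setT Y ->
  (forall B, measurable B -> P (Y @^-1` B) = normal_prob 0 (Num.sqrt s) B) ->
  (\int[P]_om (Y om ^+ 2)%:E <= (8 * s)%:E)%E.
Proof.
move=> s0 mY YB.
have mg : measurable_fun [set: measurableTypeR R] (fun x : R => (x ^+ 2)%:E).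
  by apply/measurable_EFinP; exact: measurable_funX.
pose mixin := @isMeasurableFun.Build _ _ _ (measurableTypeR R) _ mY.
pose Z : {mfun Omega >-> measurableTypeR R} := HB.pack Y mixin.
have := @ge0_integral_distribution _ _ _ _ _ P Z _ mg.
rewrite /comp => <-; last by move=> x; rewrite lee_fin sqr_ge0.
rewrite (@eq_measure_integral _ _ _ _ (normal_prob 0 (Num.sqrt s))).
  by apply: le_trans (normal_prob_sqr_le _) _; rewrite ?sqrtr_gt0// sqr_sqrtr// ltW.
by move=> B mB _; exact: YB.
Qed.

(** Each coordinate of [w s - w 0] is a centred normal variable of variance [s] and contributes at
    most [8 * s]. *)
Lemma brownian_motion_sqr_le (w : R -> Omega -> R * R) (s : R) :
  is_filtration F -> is_brownian_motion P F w -> s \in `[0, 1] ->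
  (\int[P]_om (enorm (w s om) ^+ 2)%:E <= (16 * s)%:E)%E.
Proof.
move=> HF [aw w0 _ _ wn] s01.
have z01 : 0 \in `[0 : R, 1] by rewrite in_itv/= lexx ler01.
have mw r : r \in `[0, 1] -> measurable_fun setT (w r) by exact: measurable_fun_adapted.
have mw1 r : r \in `[0, 1] -> measurable_fun setT (fun om => (w r om).1).
  by move=> r01; apply: (measurableT_comp measurable_fst (mw _ r01)).
have mw2 r : r \in `[0, 1] -> measurable_fun setT (fun om => (w r om).2).
  by move=> r01; apply: (measurableT_comp measurable_snd (mw _ r01)).
(* Time 0 is treated apart, since the law of an increment is prescribed only between distinct
   times. *)
have [->|s_neq0] := eqVneq s 0.
  rewrite mulr0 (ae_eq_integral (cst 0%E))//; first by rewrite integral0.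
    under eq_fun do rewrite enorm_sqr.
    apply/measurable_EFinP; apply: measurable_funD; apply: measurable_funX.
      exact: mw1.
    exact: mw2.
  by apply: filterS w0 => om w0 _; rewrite w0 enorm_sqr/= expr0n/= addr0.
have s0 : 0 < s.
  by rewrite lt_neqAle eq_sym s_neq0/=; move: s01; rewrite in_itv => /andP[].
pose Y1 om := (w s om).1 - (w 0 om).1; pose Y2 om := (w s om).2 - (w 0 om).2.
have mY1 : measurable_fun setT Y1 by apply: measurable_funB; exact: mw1.
have mY2 : measurable_fun setT Y2 by apply: measurable_funB; exact: mw2.
have law B : measurable B -> P ((fun om => (w s om - w 0 om)%R) @^-1` B) =
    (normal_prob 0 (Num.sqrt s) \x normal_prob 0 (Num.sqrt s))%E B.
  by move=> mB; rewrite -[in RHS](subr0 s); exact: wn.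
rewrite (ae_eq_integral (fun om => (Y1 om ^+ 2)%:E + (Y2 om ^+ 2)%:E)%E)//; first last.
- apply: filterS w0 => om w0 _; rewrite enorm_sqr /Y1 /Y2 w0 /= !subr0.
  by rewrite EFinD.
- by apply: emeasurable_funD; apply/measurable_EFinP; exact: measurable_funX.
- under eq_fun do rewrite enorm_sqr.
  by apply/measurable_EFinP; apply: measurable_funD; apply: measurable_funX;
    [exact: mw1|exact: mw2].
rewrite ge0_integralD//; first last.
- by apply/measurable_EFinP; exact: measurable_funX.
- by move=> *; rewrite lee_fin sqr_ge0.
- by apply/measurable_EFinP; exact: measurable_funX.
- by move=> *; rewrite lee_fin sqr_ge0.
have -> : (16 * s)%:E = ((8 * s)%:E + (8 * s)%:E)%E by rewrite -EFinD; congr _%:E; ring.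
have n1 : normal_prob 0 (Num.sqrt s) [set: R] = 1%E.
  exact: (@probability_setT _ (measurableTypeR R) _ (normal_prob 0 (Num.sqrt s))).
apply: leeD; apply: integral_sqr_normal_law_le => // B mB.
(* The law of one coordinate is read off from the product law on strips, whose other factor has mass
   1. *)
- transitivity (P ((fun om => (w s om - w 0 om)%R) @^-1` (B `*` setT))).
    by congr (P _); apply/seteqP; split => om //= [].
  rewrite (law _ (measurableX mB measurableT)) product_measure1E//.
  by rewrite -[RHS]mule1; congr (_ * _)%E; exact: n1.
- transitivity (P ((fun om => (w s om - w 0 om)%R) @^-1` (setT `*` B))).
    by congr (P _); apply/seteqP; split => om //= [].
  rewrite (law _ (measurableX measurableT mB)) product_measure1E//.
  by rewrite -[RHS]mul1e; congr (_ * _)%E; exact: n1.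
Qed.

End brownian_motion.

(** This is [min(max(x, 0), 1)], written with absolute values so that continuity follows from the
    arithmetic of limits. *)
Definition clamp01 {R : realType} (x : R) : R := (1 + `|x| - `|x - 1|) / 2.

Lemma clamp01_itv (R : realType) (x : R) : clamp01 x \in `[0, 1].
Proof. by rewrite in_itv/= /clamp01; case: (ger0P x); case: (ger0P (x - 1)); lra. Qed.

Lemma clamp01_id (R : realType) (x : R) : x \in `[0, 1] -> clamp01 x = x.
Proof.
rewrite in_itv/= => /andP[x0 x1].
by rewrite /clamp01 ger0_norm// ler0_norm ?subr_le0//; field.
Qed.

Lemma continuous_clamp01 (R : realType) : continuous (@clamp01 R).
Proof.
move=> x; apply: cvgM; last exact: cvg_cst.
apply: cvgB; first (apply: cvgD; [exact: cvg_cst|apply: cvg_norm; exact: cvg_id]).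
by apply: cvg_norm; apply: cvgB; [exact: cvg_id|exact: cvg_cst].
Qed.

(** On [[0, 1]], where [clamp01] takes its values, the preimage of an open set under [f] is the
    trace of an open set of the line. Paths given on the unit interval thereby extend continuously
    to all times. *)
Lemma continuous_comp_clamp01 (R : realType) (T : topologicalType) (f : R -> T) :
  {within `[0, 1], continuous f} -> continuous (f \o clamp01).
Proof.
move=> /continuousP cf; apply/continuousP => U oU.
have [V oV VU] := (open_subspaceP _ _).1 (cf _ oU).
have -> : (f \o clamp01) @^-1` U = clamp01 @^-1` V.
  apply/seteqP; split => x /= Ux.
    have : (f @^-1` U `&` `[0, 1]) (clamp01 x) by split => //; exact: clamp01_itv.
    by rewrite -VU => -[].
  have : (V `&` `[0, 1]) (clamp01 x) by split => //; exact: clamp01_itv.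
  by rewrite VU => -[].
by move: oV; apply: open_comp => x _; exact: continuous_clamp01.
Qed.

(** * The squared norm of the noise and its time average *)

Section brownian_energy.
Context {R : realType} {d : measure_display} {Omega : measurableType d}.
Variables (P : probability Omega R) (F : R -> set (set Omega)).

(** The paths of [w] are continuous only almost surely and only on [[0, 1]]. Putting the squared
    norm to zero on a null set and freezing time outside the interval gives a version that is
    continuous for every sample, as [measurable_fun_caratheodory] requires. *)
Lemma brownian_motion_sqr_modification (w : R -> Omega -> R * R) :
  is_filtration F -> is_brownian_motion P F w ->
  exists q : R -> Omega -> R,
  [/\ forall s om, 0 <= q s om, forall om, continuous (q ^~ om),
      forall s, measurable_fun setT (q s),
      {ae P, forall om, forall s, s \in `[0, 1] -> q s om = enorm (w s om) ^+ 2} &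
      forall s, s \in `[0, 1] -> (\int[P]_om (q s om)%:E <= (16 * s)%:E)%E].
Proof.
move=> HF Hw; have [aw _ [N [mN N0 NC]] _ _] := Hw.
have mw s : s \in `[0, 1] -> measurable_fun setT (fun om => enorm (w s om) ^+ 2).
  move=> s01; have m := measurable_fun_adapted HF aw s01.
  under eq_fun do rewrite enorm_sqr.
  apply: measurable_funD; apply: measurable_funX.
    exact: (measurableT_comp measurable_fst m).
  exact: (measurableT_comp measurable_snd m).
(* [N] is a measurable null set that contains every sample with a discontinuous path. *)
pose q s om := enorm (w (clamp01 s) om) ^+ 2 * \1_(~` N) om.
have mq s : measurable_fun setT (q s).
  apply: measurable_funM; first exact/mw/clamp01_itv.
  by apply: measurable_indic; exact: measurableC.
have qE : {ae P, forall om, forall s, s \in `[0, 1] -> q s om = enorm (w s om) ^+ 2}.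
  exists N; split => // om /= qN; apply: contrapT => omN; apply: qN => s s01.
  by rewrite /q clamp01_id// indicE mem_set ?mulr1.
exists q; split => //.
- by move=> s om; rewrite mulr_ge0// sqr_ge0.
- move=> om; have [omN|omN] := pselect (N om).
    rewrite (_ : q ^~ om = cst 0); first exact: cst_continuous.
    by apply/funext => s; rewrite /q indicE memNset ?mulr0//= => /(_ omN).
  have cw : {within `[0, 1], continuous (w ^~ om)}.
    by apply: contrapT => nc; exact/omN/NC.
  move=> s; apply: cvgM; last exact: cvg_cst.
  apply: (@continuous_comp _ _ _ (fun s => enorm (w (clamp01 s) om))
    (fun x : R => x ^+ 2));
    last exact: sqr_continuous.
  apply: (@continuous_comp _ _ _ ((w ^~ om) \o clamp01) (@enorm R));
    last exact: continuous_enorm.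
  exact: continuous_comp_clamp01.
- move=> s s01; apply: le_trans (brownian_motion_sqr_le HF Hw s01).
  apply: ae_ge0_le_integral => //.
  + by move=> *; rewrite lee_fin mulr_ge0// sqr_ge0.
  + exact/measurable_EFinP.
  + by move=> *; rewrite lee_fin sqr_ge0.
  + by apply/measurable_EFinP; exact: mw.
  + by apply: filterS qE => om qom _; rewrite qom.
Qed.

(** Tonelli exchanges time integral and expectation. The joint measurability it needs comes from
    [measurable_fun_caratheodory], and it also gives the measurability of the time integral as a
    function of the sample. *)
Lemma ge0_integral_time_average_le (q : R -> Omega -> R) (t c : R) :
  (forall s om, 0 <= q s om) -> (forall om, continuous (q ^~ om)) ->
  (forall s, measurable_fun setT (q s)) -> 0 < t ->
  (forall s, s \in `[0, t] -> (\int[P]_om (q s om)%:E <= c%:E)%E) ->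
  measurable_fun setT (fun om => \int[lebesgue_measure]_(s in `[0%R, t]) (q s om)%:E)%E /\
  (\int[P]_om \int[lebesgue_measure]_(s in `[0%R, t]) (q s om)%:E <= (t * c)%:E)%E.
Proof.
move=> q0 cq mq t0 qc.
(* The indicator carries the time interval, so that Tonelli applies on the whole product space. *)
pose f (p : measurableTypeR R * Omega) : \bar R := (q p.1 p.2 * \1_`[0, t] p.1)%:E.
have mf : measurable_fun setT f.
  apply/measurable_EFinP; apply: measurable_funM.
    exact: (measurable_fun_caratheodory mq cq).
  apply: (measurableT_comp _ measurable_fst).
  by apply: measurable_indic; exact: measurable_itv.
have f0 p : (0 <= f p)%E by rewrite lee_fin mulr_ge0.
have fE om : (\int[lebesgue_measure]_(s in `[0%R, t]) (q s om)%:E =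
    \int[lebesgue_measure]_s f (s, om))%E.
  by rewrite integral_mkcond epatch_indic.
rewrite (funext fE).
split; first exact: (measurable_fun_fubini_tonelli_G f mf f0).
rewrite -(@fubini_tonelli _ _ _ _ _ lebesgue_measure P f mf f0).
have -> : (t * c)%:E = (\int[lebesgue_measure]_(s in `[0%R, t]) (cst c%:E) s)%E.
  by rewrite integral_cst//= lebesgue_measure_itv/= lte_fin t0 oppr0 adde0 muleC EFinM.
rewrite [leRHS]integral_mkcond epatch_indic.
apply: ge0_le_integral => //.
- by move=> s _; apply: integral_ge0.
- exact: (measurable_fun_fubini_tonelli_F f mf f0).
- apply: emeasurable_funM => //; apply/measurable_EFinP.
  by apply: measurable_indic; exact: measurable_itv.
move=> s _; rewrite /f /= indicE.
have [s0t|s0t] := boolP (s \in `[0, t]%classic).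
  under eq_integral do rewrite mulr1.
  by rewrite mule1; apply: qc; rewrite inE in s0t.
under eq_integral do rewrite mulr0.
by rewrite integral0 mule0.
Qed.

End brownian_energy.

(** * The pathwise estimate *)

Lemma continuous_comp_within (T U V : topologicalType) (A : set T)
    (f : T -> U) (g : U -> V) :
  {within A, continuous f} -> continuous g -> {within A, continuous (g \o f)}.
Proof.
by move=> cf cg x; apply: (@continuous_comp (subspace A)); [exact: cf|exact: cg].
Qed.

(** Young's inequality with conjugate exponents [1 / (1 - alpha)] and [1 / alpha]; the second one
    turns the power of [y] into [y] itself. *)
Lemma young_powR (R : realType) (alpha x y : R) :
  0 < alpha -> alpha < 1 -> 0 <= x -> 0 <= y ->
  x * y `^ alpha <= (1 - alpha) * x `^ (1 - alpha)^-1 + alpha * y.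
Proof.
move=> a0 a1 x0 y0; have b0 : 0 < 1 - alpha by rewrite subr_gt0.
have := @conjugate_powR R x (y `^ alpha) (1 - alpha)^-1 alpha^-1.
rewrite !invrK -powRrM mulfV ?gt_eqF// powRr1// [_ * (1 - _)]mulrC [_ * alpha]mulrC.
by apply; rewrite ?powR_ge0 ?invr_gt0//; ring.
Qed.

(** * A Gronwall estimate under a Hoelder bound *)

Section pathwise_gronwall.
Context {R : realType}.
Local Notation mu := (@lebesgue_measure R).

Lemma ae_le_Rintegral (D : set (measurableTypeR R)) (f g : R -> R) :
  measurable D -> mu.-integrable D (EFin \o f) -> mu.-integrable D (EFin \o g) ->
  (forall x, D x -> 0 <= f x) -> (forall x, D x -> 0 <= g x) ->
  {ae mu, forall x, D x -> f x <= g x} ->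
  \int[mu]_(x in D) f x <= \int[mu]_(x in D) g x.
Proof.
move=> mD fi gi f0 g0 fg; apply: fine_le; [exact: integrable_fin_num..|].
apply: ae_ge0_le_integral => //.
- by case/integrableP : fi.
- by case/integrableP : gi.
Qed.

Lemma within_itv_integrable (f : R -> R) (a b : R) :
  {within `[a, b], continuous f} -> mu.-integrable `[a, b] (EFin \o f).
Proof.
move=> cf; apply: continuous_compact_integrable => //.
exact: segment_compact.
Qed.

Lemma Rintegral_cst_itv (t c : R) : 0 <= t -> \int[mu]_(s in `[0, t]) c = t * c.
Proof.
move=> t0; rewrite Rintegral_cst//= lebesgue_measure_itv/= lte_fin.
case: ltP => [_|t0']; first by rewrite oppr0 adde0 mulrC.
by have -> : t = 0 by [lra]; rewrite mulr0 mul0r.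
Qed.

(** With [m] the mean of [a], this is the integrated form of [(a s - m) ^+ 2 >= 0]. *)
Lemma sqr_mean_le_mean_sqr (a : R -> R) (t : R) : 0 < t ->
  {within `[0, t], continuous a} ->
  (t^-1 * \int[mu]_(s in `[0, t]) a s) ^+ 2 <=
  t^-1 * \int[mu]_(s in `[0, t]) (a s ^+ 2).
Proof.
move=> t0 ca; set m := t^-1 * _.
have ia := within_itv_integrable ca.
have ca2 : {within `[0, t], continuous (fun s => a s ^+ 2)}.
  by apply: (continuous_comp_within (g := fun x : R => x ^+ 2) ca);
      exact: sqr_continuous.
have ia2 := within_itv_integrable ca2.
have mI : \int[mu]_(s in `[0, t]) a s = t * m.
  by rewrite /m mulrA mulfV ?mul1r// gt_eqF.
have ic c : mu.-integrable `[0, t] (EFin \o (fun=> c)).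
  by apply: within_itv_integrable; apply: cst_continuous.
have i2a : mu.-integrable `[0, t] (EFin \o (fun s => 2 * m * a s)).
  by apply: within_itv_integrable => s; apply: cvgM; [exact: cvg_cst|exact: ca].
have : \int[mu]_(s in `[0, t]) (2 * m * a s) <=
    \int[mu]_(s in `[0, t]) (a s ^+ 2 + m ^+ 2).
  apply: le_Rintegral => //.
  - by apply: within_itv_integrable => s; apply: cvgD; [exact: ca2|exact: cvg_cst].
  - by move=> s _; rewrite -subr_ge0 (_ : _ - _ = (a s - m) ^+ 2) ?sqr_ge0//; ring.
rewrite RintegralZl// RintegralD// (Rintegral_cst_itv _ (ltW t0)) mI => h.
rewrite mulrC ler_pdivlMr//; lra.
Qed.

(* Young's inequality makes the Hoelder bound linear in [2 H(s) + a s]; since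
   [H] is nondecreasing, integrating it over [0, t] closes on [H(t)] itself. *)
Lemma holder_gronwall (alpha N t : R) (h a : R -> R) :
  0 < alpha -> alpha < 1 -> 0 <= N -> 0 < t ->
  (forall s, 0 <= h s) -> (forall s, 0 <= a s) ->
  mu.-integrable `[0, t] (EFin \o h) ->
  {within `[0, t], continuous a} ->
  {ae mu, forall s, s \in `[0, t] ->
    h s <= N * (2 * (\int[mu]_(r in `[0, s]) h r) + a s) `^ alpha} ->
  2 * (\int[mu]_(s in `[0, t]) h s) <=
    (2 * N * t) `^ (1 - alpha)^-1 +
    alpha / (1 - alpha) * (t^-1 * \int[mu]_(s in `[0, t]) a s).
Proof.
move=> al0 al1 N0 t0 h0 a0 ih ca hle.
set K := _ `^ _; set H := \int[mu]_(s in _) h s; set A := \int[mu]_(s in _) a s.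
have K0 : 0 <= K by exact: powR_ge0.
have H0 : 0 <= H by exact: Rintegral_ge0.
have ia := within_itv_integrable ca.
have ic c : mu.-integrable `[0, t] (EFin \o (fun=> c)).
  by apply: within_itv_integrable; apply: cst_continuous.
(* [c] is the part of Young's bound for [2 * t * h s] that no longer depends on [s], the integral up
   to [s] having been replaced by the one up to [t]. *)
pose c := (1 - alpha) * K + alpha * (2 * H).
have c0 : 0 <= c.
  by apply: addr_ge0; apply: mulr_ge0; rewrite ?mulr_ge0 ?subr_ge0//; exact: ltW.
have : \int[mu]_(s in `[0, t]) (2 * t * h s) <=
    \int[mu]_(s in `[0, t]) (c + alpha * a s).
  apply: ae_le_Rintegral => //.
  - under [X in _.-integrable _ X]eq_fun do rewrite /= EFinM.
    exact: integrableZl.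
  - by apply: within_itv_integrable => s; apply: cvgD;
      [exact: cvg_cst|apply: cvgM; [exact: cvg_cst|exact: ca]].
  - by move=> s _; rewrite !mulr_ge0// ltW.
  - by move=> s _; rewrite addr_ge0// mulr_ge0// ltW.
  case: hle => Z [mZ Z0 ZC]; exists Z; split => //.
  apply: subset_trans ZC; apply: subsetC => s hs s0t; have {}hs := hs s0t.
  have /andP[_ st] : 0 <= s <= t by move: s0t; rewrite /= in_itv.
  have Hs : \int[mu]_(r in `[0, s]) h r <= H.
    apply: fine_le.
    - apply: integrable_fin_num => //; apply: integrableS ih => //.
      by apply: subset_itvl; rewrite bnd_simp.
    - exact: integrable_fin_num.
    apply: ge0_subset_integral => //.
    - by case/integrableP : ih.
    - by move=> *; rewrite lee_fin.
    - by apply: subset_itvl; rewrite bnd_simp.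
  set Hs' := \int[mu]_(r in _) h r in Hs hs.
  have Hs0 : 0 <= Hs' by exact: Rintegral_ge0.
  have D0 : 0 <= 2 * Hs' + a s by rewrite addr_ge0// mulr_ge0.
  have x0 : 0 <= 2 * N * t by rewrite !mulr_ge0// ltW.
  have y := young_powR al0 al1 x0 D0.
  have : 2 * t * h s <= 2 * t * (N * (2 * Hs' + a s) `^ alpha).
    by apply: ler_wpM2l => //; rewrite mulr_ge0// ltW.
  have : alpha * Hs' <= alpha * H by rewrite ler_pM2l.
  rewrite -/K in y; rewrite /c; lra.
rewrite RintegralZl// RintegralD//; last first.
  under [X in _.-integrable _ X]eq_fun do rewrite /= EFinM.
  exact: integrableZl.
rewrite RintegralZl// (Rintegral_cst_itv _ (ltW t0)) -/H -/A /c => hh.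
have b0 : 0 < 1 - alpha by rewrite subr_gt0.
have tb : 0 < t * (1 - alpha) by rewrite mulr_gt0.
(* The integrated bound reads [2 * t * H <= t * (1 - alpha) * K + 2 * alpha * t * H + alpha * A]. As
   [alpha < 1], the term in [H] is absorbed on the left, which leaves the factor
   [t * (1 - alpha)]. *)
rewrite -(ler_pM2l tb).
have -> : t * (1 - alpha) * (K + alpha / (1 - alpha) * (t^-1 * A)) =
  t * (1 - alpha) * K + alpha * A by field; rewrite !gt_eqF.
lra.
Qed.

(** Squares [holder_gronwall] by [(x + y + z)^2 <= 3 (x^2 + y^2 + z^2)] and replaces the squared
    mean of [a] by the mean of its majorant [b]. The resulting bound is linear in [b], so that
    expectations can be taken. *)
Lemma holder_gronwall_sqr (alpha N t : R) (h a b : R -> R) :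
  0 < alpha -> alpha < 1 -> 0 <= N -> 0 < t ->
  (forall s, 0 <= h s) -> (forall s, 0 <= a s) ->
  mu.-integrable `[0, t] (EFin \o h) ->
  {within `[0, t], continuous a} -> {within `[0, t], continuous b} ->
  (forall s, s \in `[0, t] -> a s ^+ 2 <= b s) ->
  {ae mu, forall s, s \in `[0, t] ->
    h s <= N * (2 * (\int[mu]_(r in `[0, s]) h r) + a s) `^ alpha} ->
  (2 * (\int[mu]_(s in `[0, t]) h s) + a t) ^+ 2 <=
    3 * ((2 * N * t) `^ (1 - alpha)^-1) ^+ 2 +
    3 * ((alpha / (1 - alpha)) ^+ 2 + 1) *
      (b t + t^-1 * \int[mu]_(s in `[0, t]) b s).
Proof.
move=> al0 al1 N0 t0 h0 a0 ih ca cb ab hle.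
have := holder_gronwall al0 al1 N0 t0 h0 a0 ih ca hle.
have := sqr_mean_le_mean_sqr t0 ca.
have : t^-1 * \int[mu]_(s in `[0, t]) (a s ^+ 2) <= t^-1 * \int[mu]_(s in `[0, t]) b s.
  rewrite ler_pM2l ?invr_gt0//; apply: le_Rintegral => //.
  - apply: within_itv_integrable.
    by apply: (continuous_comp_within (g := fun x : R => x ^+ 2) ca);
      exact: sqr_continuous.
  - exact: within_itv_integrable.
set K := _ `^ _; set H := \int[mu]_(s in _) h s; set m := t^-1 * \int[mu]_(s in _) a s.
set B := t^-1 * \int[mu]_(s in _) b s; set c := alpha / _; set m2 := t^-1 * _.
move=> h1 h2 h3.
have H0 : 0 <= H by exact: Rintegral_ge0.
have m0 : 0 <= m by rewrite mulr_ge0 ?Rintegral_ge0// invr_ge0 ltW.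
have at2 : a t ^+ 2 <= b t by apply: ab; rewrite in_itv/= lexx ltW.
have K0 : 0 <= K by exact: powR_ge0.
have c0 : 0 <= c by rewrite divr_ge0 ?subr_ge0// ltW.
have h4 : (2 * H + a t) ^+ 2 <= (K + c * m + a t) ^+ 2.
  have := mulr_ge0 c0 m0; have := a0 t => at0 cm0.
  by rewrite ler_sqr ?nnegrE ?lerD2r//; lra.
apply: (le_trans h4).
have h5 : (K + c * m + a t) ^+ 2 <= 3 * K ^+ 2 + 3 * (c ^+ 2 * m ^+ 2) + 3 * a t ^+ 2.
  rewrite -subr_ge0 (_ : _ - _ = (K - c * m) ^+ 2 + (K - a t) ^+ 2 + (c * m - a t) ^+ 2).
    by rewrite !addr_ge0 ?sqr_ge0.
  by ring.
apply: (le_trans h5).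
have h6 : c ^+ 2 * m ^+ 2 <= c ^+ 2 * B.
  by rewrite ler_wpM2l ?sqr_ge0//; exact: le_trans h1.
(* These two signs allow the coefficients [3] of [b t] and [3 * c ^+ 2] of [B] to be raised to the
   common value [3 * (c ^+ 2 + 1)]. *)
have h7 : 0 <= B by apply: le_trans h1; apply: le_trans h2; rewrite sqr_ge0.
have h8 : 0 <= c ^+ 2 * b t.
  by rewrite mulr_ge0 ?sqr_ge0//; apply: le_trans at2; rewrite sqr_ge0.
lra.
Qed.

End pathwise_gronwall.

(** Both suprema in the norm are nonnegative, so each of them is bounded by the sum. *)
Lemma holder_norm_leP (R : realType) (alpha N : R) (f : torus R -> R * R) :
  0 < alpha -> (holder_norm alpha f <= N%:E)%E ->
  (forall x, enorm (f x) <= N) /\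
  (forall x y, enorm (f x - f y) <= N * torus_dist x y `^ alpha).
Proof.
move=> al0; rewrite /holder_norm; set s1 := ereal_sup _; set s2 := ereal_sup _ => fN.
have s1x x : ((enorm (f x))%:E <= s1)%E by apply: ereal_sup_ubound; exists x.
have s2p x y : x != y ->
    ((enorm (f x - f y) / torus_dist x y `^ alpha)%:E <= s2)%E.
  by move=> xy; apply: ereal_sup_ubound; exists (x, y).
have s10 : (0 <= s1)%E.
  by apply: le_trans (s1x (torus_proj (0, 0))); rewrite lee_fin sqrtr_ge0.
have s20 : (0 <= s2)%E.
  (* A supremum over the empty set would be [-oo], so nonnegativity of the Hoelder seminorm needs a
     pair of distinct points. *)
  have xy : torus_proj (0, 0) != torus_proj (0, 2^-1) :> torus R.
    rewrite torus_proj_eq; apply/asboolP => -[k [l [_ /= hl]]].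
    have l1 : `|l%:~R : R| < 1 by rewrite -hl sub0r normrN ger0_norm; lra.
    by move: hl; rewrite (intr_norm_lt1 l1); lra.
  apply: le_trans (s2p _ _ xy).
  by rewrite lee_fin divr_ge0 ?sqrtr_ge0 ?powR_ge0.
split=> [x|x y].
  by rewrite -lee_fin; apply: le_trans fN; apply: le_trans (s1x x) _; exact: leeDl.
have [->|xy] := eqVneq x y.
  rewrite subrr /enorm/= expr0n/= addr0 sqrtr0 mulr_ge0 ?powR_ge0//.
  by rewrite -lee_fin; apply: le_trans fN; exact: adde_ge0.
(* Distinct points have positive distance, so the quotient in the seminorm is a genuine division. *)
have d0 : 0 < torus_dist x y `^ alpha by rewrite powR_gt0// torus_dist_gt0.
rewrite -ler_pdivrMr// -lee_fin; apply: le_trans fN.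
by apply: le_trans (s2p _ _ xy) _; exact: leeDr.
Qed.

(** A finite essential supremum is itself an almost everywhere bound, so [N] can be the norm of [u]
    exactly. *)
Lemma in_Linf_holder_ae (R : realType) (alpha : R) (u : R -> torus R -> R * R) :
  in_Linf_holder alpha u ->
  exists N : R, [/\ 0 <= N, Linf_holder_norm alpha u = N%:E &
    {ae lebesgue_measure, forall s : R, s \in `[0, 1] ->
      (holder_norm alpha (u s) <= N%:E)%E}].
Proof.
move=> [_ uoo]; exists (fine (Linf_holder_norm alpha u)).
have u0 : (0 <= Linf_holder_norm alpha u)%E by exact: Lnorm_ge0.
have uE : Linf_holder_norm alpha u = (fine (Linf_holder_norm alpha u))%:E.
  by rewrite fineK// ge0_fin_numE.
split; [exact: fine_ge0|exact: uE|].
rewrite -uE.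
(* At exponent [+oo], [Lnorm] is the essential supremum under the condition that the total mass is
   positive. *)
have mT : (0 < mrestr (@lebesgue_measure R)
   (measurable_itv `[0%R, 1%R] : measurable (`[0%R, 1%R]%classic : set R)) [set: R])%E.
  by rewrite /mrestr setTI /= lebesgue_measure_itv/= lte01 oppr0 adde0 lte01.
have [Z [mZ Z0 ZC]] := ess_sup_ge (mrestr (@lebesgue_measure R)
   (measurable_itv `[0%R, 1%R] : measurable (`[0%R, 1%R]%classic : set R)))
  (abse \o (fun t => holder_norm alpha (u t))).
(* [Z] is null for the restricted measure, which means that its trace on [[0, 1]] is null for
   Lebesgue measure. *)
exists (Z `&` `[0, 1]%classic); split => //; first exact: measurableI.
move=> s /= hs; apply: contrapT => sZ; apply: hs => s01.
rewrite /Linf_holder_norm unlock /Lnorm mT.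
apply: contrapT => hs; apply: sZ; split => //; apply: ZC => /= hs'; apply: hs.
by apply: le_trans hs'; exact: lee_abs.
Qed.

(** * Measurability and integrability of the drift along a path *)

Section path.
Context {R : realType}.
Local Notation mu := (@lebesgue_measure R).

(** The path frozen outside [[0, 1]] is continuous, hence Borel, and the drift is composed with the
    measurable map [s |-> (s, X s)]. *)
Lemma measurable_fun_path (u : R -> torus R -> R * R) (X : R -> torus R) :
  measurable_fun ((`[0%R, 1%R]%classic : set R) `*` [set: torus R])
    (fun p : R * torus R => u p.1 p.2) ->
  {within `[0, 1], continuous X} ->
  measurable_fun (`[0%R, 1%R]%classic : set R) (fun s => u s (X s)).
Proof.
move=> mu_ cX.
have mX : measurable_fun [set: R] (X \o clamp01).
  apply: (measurability _ (erefl : @measurable _ (torus R) = <<s @open (torus R) >>)).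
  move=> _ [V oV <-]; rewrite setTI; apply: open_measurable.
  by move/continuousP : (continuous_comp_clamp01 cX); exact.
apply: (@eq_measurable_fun _ _ _ _ _ (fun s => u s (X (clamp01 s)))).
  by move=> s; rewrite inE/= => s01; rewrite clamp01_id.
apply: (@measurable_comp _ _ _ _ _ _ ((`[0%R, 1%R]%classic : set R) `*` [set: torus R])
  (fun p : R * torus R => u p.1 p.2) _ (fun s => (s, X (clamp01 s)))) => //.
- by apply: measurableX => //; exact: measurable_itv.
- by move=> _ [s s01 <-]; split.
- by apply: measurable_funTS; exact: measurable_fun_pair.
Qed.

Lemma ae_bounded_integrable (g : R -> R) (t N : R) :
  measurable_fun `[0, t] g ->
  {ae mu, forall s, s \in `[0, t] -> `|g s| <= N} ->
  mu.-integrable `[0, t] (EFin \o g).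
Proof.
move=> mg gN; apply/integrableP; split; first exact/measurable_EFinP.
apply: (@le_lt_trans _ _ (\int[mu]_(s in `[0%R, t]) (cst `|N|%:E s))%E).
  apply: ae_ge0_le_integral => //.
  - by apply/measurable_EFinP; exact: measurableT_comp.
  - by move=> *; rewrite lee_fin.
  - case: gN => Z [mZ Z0 ZC]; exists Z; split => //.
    apply: subset_trans ZC; apply: subsetC => s /= hs s0t.
    by rewrite lee_fin; apply: (le_trans (hs s0t)); exact: ler_norm.
rewrite integral_cst//= lebesgue_measure_itv/=.
by case: ifP => _; rewrite ?mule0 ?ltry// -EFinN -EFinD -EFinM ltry.
Qed.

Lemma norm_RintegralB_le (f g h : R -> R) (t : R) :
  mu.-integrable `[0, t] (EFin \o f) -> mu.-integrable `[0, t] (EFin \o g) ->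
  mu.-integrable `[0, t] (EFin \o h) -> (forall s, `|f s - g s| <= h s) ->
  `|\int[mu]_(s in `[0, t]) f s - \int[mu]_(s in `[0, t]) g s| <=
  \int[mu]_(s in `[0, t]) h s.
Proof.
move=> fi gi hi fgh; rewrite -RintegralB//.
have fgi : mu.-integrable `[0, t] (EFin \o (f \- g)).
  by apply: (@integrableB _ _ _ mu _ (measurable_itv _) _ _ fi gi).
apply: le_trans (le_normr_Rintegral _ fgi) _ => //.
apply: le_Rintegral => //; [exact: (integrable_abse fgi)|by move=> s _; exact: fgh].
Qed.

End path.

(** The statement is deterministic: [X] and [Y] stand for two fixed samples with noises [v] and [w].
    Both are lifted from the same representative of [x], so their lifted difference consists of a
    drift part and a noise part, to which [holder_gronwall_sqr] applies. *)
Lemma torus_dist_sde_paths_le (R : realType) (alpha N kappa t : R)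
    (u : R -> torus R -> R * R) (x : torus R) (X Y : R -> torus R)
    (v w : R -> R * R) (p q : R -> R) :
  0 < alpha -> alpha < 1 -> 0 <= N -> 0 <= kappa -> 0 < t -> t <= 1 ->
  measurable_fun ((`[0%R, 1%R]%classic : set R) `*` [set: torus R])
    (fun p : R * torus R => u p.1 p.2) ->
  {ae lebesgue_measure, forall s : R, s \in `[0, 1] ->
    (holder_norm alpha (u s) <= N%:E)%E} ->
  {within `[0, 1], continuous X} -> {within `[0, 1], continuous Y} ->
  {within `[0, 1], continuous v} -> {within `[0, 1], continuous w} ->
  continuous p -> continuous q ->
  (forall s, s \in `[0, 1] -> p s = enorm (v s) ^+ 2) ->
  (forall s, s \in `[0, 1] -> q s = enorm (w s) ^+ 2) ->
  (forall s, s \in `[0, 1] -> X s = torus_add x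
    ((\int[lebesgue_measure]_(r in `[0, s]) (u r (X r)).1,
      \int[lebesgue_measure]_(r in `[0, s]) (u r (X r)).2) +
     (Num.sqrt (2 * kappa) * (v s).1, Num.sqrt (2 * kappa) * (v s).2))) ->
  (forall s, s \in `[0, 1] -> Y s = torus_add x
    ((\int[lebesgue_measure]_(r in `[0, s]) (u r (Y r)).1,
      \int[lebesgue_measure]_(r in `[0, s]) (u r (Y r)).2) +
     (Num.sqrt (2 * kappa) * (w s).1, Num.sqrt (2 * kappa) * (w s).2))) ->
  torus_dist (X t) (Y t) ^+ 2 <=
    3 * ((2 * N * t) `^ (1 - alpha)^-1) ^+ 2 +
    24 * ((alpha / (1 - alpha)) ^+ 2 + 1) * kappa *
      ((p t + t^-1 * \int[lebesgue_measure]_(s in `[0, t]) p s) +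
       (q t + t^-1 * \int[lebesgue_measure]_(s in `[0, t]) q s)).
Proof.
move=> al0 al1 N0 k0 t0 t1 mu_ uN cX cY cv cw cp cq pE qE XE YE.
pose mu := @lebesgue_measure R.
pose sk := Num.sqrt (2 * kappa).
have sk0 : 0 <= sk by exact: sqrtr_ge0.
have sk2 : sk ^+ 2 = 2 * kappa by rewrite sqr_sqrtr// mulr_ge0.
pose h s := enorm (u s (X s) - u s (Y s)).
pose a s := sk * (`|(v s).1| + `|(v s).2| + `|(w s).1| + `|(w s).2|).
(* The factor 8 is 2 from [sk ^+ 2 = 2 * kappa] times 4 from bounding the square of a sum of four
   terms by the sum of squares. *)
pose b s := 8 * kappa * (p s + q s).
have h0 s : 0 <= h s by exact: sqrtr_ge0.
have a0 s : 0 <= a s by rewrite mulr_ge0// !addr_ge0.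
have sub01 s : s <= 1 -> `[0, s] `<=` `[0, 1].
  by move=> s1; apply: subset_itvl; rewrite bnd_simp.
have mX := measurable_fun_path mu_ cX.
have mY := measurable_fun_path mu_ cY.
have m1 (Z : R -> torus R) :
    measurable_fun (`[0%R, 1%R]%classic : set R) (fun s => u s (Z s)) ->
    measurable_fun (`[0%R, 1%R]%classic : set R) (fun s => (u s (Z s)).1).
  by move=> mZ; apply: (measurableT_comp measurable_fst mZ).
have m2 (Z : R -> torus R) :
    measurable_fun (`[0%R, 1%R]%classic : set R) (fun s => u s (Z s)) ->
    measurable_fun (`[0%R, 1%R]%classic : set R) (fun s => (u s (Z s)).2).
  by move=> mZ; apply: (measurableT_comp measurable_snd mZ).
have mh : measurable_fun (`[0%R, 1%R]%classic : set R) h.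
  apply: (measurableT_comp (continuous_measurable_fun (@sqrt_continuous R))).
  by apply: measurable_funD; apply: measurable_funX; apply: measurable_funB;
    [exact: m1|exact: m1|exact: m2|exact: m2].
have bnd (g : R -> R) (s M : R) : s <= 1 ->
    measurable_fun (`[0%R, 1%R]%classic : set R) g ->
    (forall r, (holder_norm alpha (u r) <= N%:E)%E -> `|g r| <= M) ->
    mu.-integrable `[0, s] (EFin \o g).
  move=> s1 mg gM; apply: (@ae_bounded_integrable _ _ _ M).
    by apply: (measurable_funS (measurable_itv _) _ mg); exact: sub01.
  case: uN => Z [mZ Z0 ZC]; exists Z; split => //.
  apply: subset_trans ZC; apply: subsetC => r /= hr r0s; apply: gM; apply: hr.
  exact: sub01 r0s.
have uint1 (Z : R -> torus R) s : s <= 1 ->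
    measurable_fun (`[0%R, 1%R]%classic : set R) (fun s => u s (Z s)) ->
    mu.-integrable `[0, s] (EFin \o (fun r => (u r (Z r)).1)).
  move=> s1 mZ; apply: (bnd _ _ N s1 (m1 _ mZ)) => r /(holder_norm_leP al0)[hr _].
  by apply: le_trans (hr (Z r)); have [] := ler_norm_enorm (u r (Z r)).
have uint2 (Z : R -> torus R) s : s <= 1 ->
    measurable_fun (`[0%R, 1%R]%classic : set R) (fun s => u s (Z s)) ->
    mu.-integrable `[0, s] (EFin \o (fun r => (u r (Z r)).2)).
  move=> s1 mZ; apply: (bnd _ _ N s1 (m2 _ mZ)) => r /(holder_norm_leP al0)[hr _].
  by apply: le_trans (hr (Z r)); have [] := ler_norm_enorm (u r (Z r)).
have hint s : s <= 1 -> mu.-integrable `[0, s] (EFin \o h).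
  (* A crude bound suffices for integrability: each of the two coordinates of the difference is at
     most [2 * N]. *)
  move=> s1; apply: (bnd _ _ (2 * N + 2 * N) s1 mh) => r /(holder_norm_leP al0)[hr _].
  rewrite ger0_norm//; apply: le_trans (enorm_le _) _ => /=.
  have [x1 x2] := ler_norm_enorm (u r (X r)).
  have [y1 y2] := ler_norm_enorm (u r (Y r)).
  have := ler_normB (u r (X r)).1 (u r (Y r)).1.
  have := ler_normB (u r (X r)).2 (u r (Y r)).2.
  have := hr (X r); have := hr (Y r); lra.
(* The factor 2 arises because the Euclidean norm is bounded by the sum of two coordinates, whose
   drift parts are each at most the integral of [h]. *)
have dist_le s : s \in `[0, 1] ->
    torus_dist (X s) (Y s) <= 2 * (\int[mu]_(r in `[0, s]) h r) + a s.
  move=> s01; have /andP[s0 s1] : 0 <= s <= 1 by move: s01; rewrite in_itv.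
  rewrite XE// YE// /torus_add; apply: le_trans (torus_dist_proj_le _ _) _.
  apply: le_trans (enorm_le _) _ => /=.
  have d1 := norm_RintegralB_le (uint1 _ _ s1 mX) (uint1 _ _ s1 mY) (hint _ s1)
    (fun r => (ler_norm_enorm (u r (X r) - u r (Y r))).1).
  have d2 := norm_RintegralB_le (uint2 _ _ s1 mX) (uint2 _ _ s1 mY) (hint _ s1)
    (fun r => (ler_norm_enorm (u r (X r) - u r (Y r))).2).
  move: d1 d2; rewrite -/mu -/sk.
  set I1 := \int[mu]_(r in _) _; set J1 := \int[mu]_(r in _) _.
  set H := \int[mu]_(r in _) h r; set I2 := \int[mu]_(r in _) _.
  set J2 := \int[mu]_(r in _) _ => d1 d2.
  have tri (c I J y z : R) : `|I - J| <= H ->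
      `|c + (I + sk * y) - (c + (J + sk * z))| <= H + sk * (`|y| + `|z|).
    move=> IJ; rewrite (_ : _ - _ = (I - J) + (sk * y - sk * z)); last by ring.
    apply: le_trans (ler_normD _ _) _; apply: lerD => //.
    by apply: le_trans (ler_normB _ _) _; rewrite !normrM (ger0_norm sk0) mulrDr.
  have := tri (repr x).1 _ _ (v s).1 (w s).1 d1.
  have := tri (repr x).2 _ _ (v s).2 (w s).2 d2.
  by rewrite /a; lra.
have cwi (f : R -> R) : {within `[0, 1], continuous f} -> {within `[0, t], continuous f}.
  by apply: continuous_subspaceW; exact: sub01.
have cnorm1 (z : R -> R * R) : {within `[0, 1], continuous z} ->
    {within `[0, 1], continuous (fun s => `|(z s).1|)}.
  move=> cz; apply: (continuous_comp_within (g := fun y : R * R => `|y.1|) cz).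
  by move=> y; apply: cvg_norm; exact: cvg_fst.
have cnorm2 (z : R -> R * R) : {within `[0, 1], continuous z} ->
    {within `[0, 1], continuous (fun s => `|(z s).2|)}.
  move=> cz; apply: (continuous_comp_within (g := fun y : R * R => `|y.2|) cz).
  by move=> y; apply: cvg_norm; exact: cvg_snd.
have ca : {within `[0, 1], continuous a}.
  move=> s; apply: cvgM; first exact: cvg_cst.
  apply: cvgD; last exact: cnorm2.
  apply: cvgD; last exact: cnorm1.
  by apply: cvgD; [exact: cnorm1|exact: cnorm2].
have cb : continuous b.
  by move=> s; apply: cvgM; [exact: cvg_cst|apply: cvgD; [exact: cp|exact: cq]].
have ab s : s \in `[0, t] -> a s ^+ 2 <= b s.
  move=> s0t; have s01 : s \in `[0, 1] by exact: sub01 s0t.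
  rewrite /a /b exprMn sk2 pE// qE// !enorm_sqr.
  rewrite -!(real_normK (num_real (v s).1)) -!(real_normK (num_real (v s).2)).
  rewrite -!(real_normK (num_real (w s).1)) -!(real_normK (num_real (w s).2)).
  move: `|(v s).1| `|(v s).2| `|(w s).1| `|(w s).2| => y1 y2 y3 y4.
  rewrite (_ : 8 * kappa * _ =
    2 * kappa * (4 * (y1 ^+ 2 + y2 ^+ 2 + (y3 ^+ 2 + y4 ^+ 2)))); last by ring.
  apply: ler_wpM2l; first by rewrite mulr_ge0.
  rewrite -subr_ge0 (_ : _ - _ = (y1 - y2) ^+ 2 + (y1 - y3) ^+ 2 + (y1 - y4) ^+ 2 +
    (y2 - y3) ^+ 2 + (y2 - y4) ^+ 2 + (y3 - y4) ^+ 2); last by ring.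
  by rewrite !addr_ge0 ?sqr_ge0.
have hle : {ae mu, forall s, s \in `[0, t] ->
    h s <= N * (2 * (\int[mu]_(r in `[0, s]) h r) + a s) `^ alpha}.
  case: uN => Z [mZ Z0 ZC]; exists Z; split => //.
  apply: subset_trans ZC; apply: subsetC => s /= hs s0t.
  have s01 : s \in `[0, 1] by exact: sub01 s0t.
  have [_ hol] := holder_norm_leP al0 (hs s01).
  apply: le_trans (hol (X s) (Y s)) _; apply: ler_wpM2l => //.
  have d0 := torus_dist_ge0 (X s) (Y s); have dl := dist_le s s01.
  by rewrite ge0_ler_powR ?nnegrE//; [exact: ltW|exact: le_trans dl].
have := holder_gronwall_sqr al0 al1 N0 t0 h0 a0 (hint _ t1) (cwi _ ca)
  (continuous_subspaceT cb) ab hle.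
have t01 : t \in `[0, 1] by rewrite in_itv/= t1 ltW.
have dt : torus_dist (X t) (Y t) ^+ 2 <= (2 * (\int[mu]_(r in `[0, t]) h r) + a t) ^+ 2.
  have d0 := torus_dist_ge0 (X t) (Y t); have dl := dist_le _ t01.
  by rewrite ler_sqr ?nnegrE//; exact: le_trans dl.
move=> main; apply: (le_trans dt); apply: (le_trans main).
have ip := within_itv_integrable (continuous_subspaceT cp : {within `[0, t], continuous p}).
have iq := within_itv_integrable (continuous_subspaceT cq : {within `[0, t], continuous q}).
have -> : \int[mu]_(s in `[0, t]) b s = 8 * kappa *
    (\int[mu]_(s in `[0, t]) p s + \int[mu]_(s in `[0, t]) q s).
  rewrite RintegralZl// ?RintegralD//.
  by apply: within_itv_integrable; apply: continuous_subspaceT => s; apply: cvgD;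
    [exact: cp|exact: cq].
by rewrite /b lerD2l le_eqVlt; apply/orP; left; apply/eqP; ring.
Qed.

(** * The variance *)

Lemma torus_variance_le (R : realType) (d : measure_display)
    (Omega : measurableType d) (P : probability Omega R) (Y : Omega -> torus R)
    (a : torus R) : measurable_fun setT Y ->
  (torus_variance P Y <= \int[P]_om (torus_dist (Y om) a ^+ 2)%:E)%E.
Proof.
move=> mY; rewrite /torus_variance /variance_law.
apply: ereal_inf_lbound; exists a => //.
rewrite (ge0_integral_pushforward mY)//.
- by apply/measurable_EFinP; apply: measurable_funX; exact: measurable_torus_dist.
- by move=> y _; rewrite lee_fin sqr_ge0.
Qed.

(** Otherwise [f] would exceed [c'] almost surely and its mean would be at least [c']. The event [Q]
    lets the selected sample also satisfy all almost sure properties. *)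
Lemma ae_exists_le_mean (R : realType) (d : measure_display)
    (Omega : measurableType d) (P : probability Omega R) (f : Omega -> R)
    (Q : Omega -> Prop) (c c' : R) :
  measurable_fun setT f -> (forall om, 0 <= f om) -> 0 <= c < c' ->
  (\int[P]_om (f om)%:E <= c%:E)%E -> {ae P, forall om, Q om} ->
  exists om, Q om /\ f om <= c'.
Proof.
move=> mf f0 /andP[c0 cc'] fc Qae; apply: contrapT => nQ.
have : (\int[P]_om (cst c'%:E) om <= \int[P]_om (f om)%:E)%E.
  apply: ae_ge0_le_integral => //.
  - by move=> *; rewrite lee_fin; apply: ltW; exact: le_lt_trans cc'.
  - by move=> *; rewrite lee_fin.
  - exact/measurable_EFinP.
  - apply: filterS Qae => om Qom _; rewrite lee_fin leNgt; apply/negP => /ltW fom.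
    by apply: nQ; exists om.
rewrite integral_cst//= probability_setT mule1 => h.
by have := le_trans h fc; rewrite lee_fin leNgt cc'.
Qed.

Theorem proposition1p9 (R : realType) (alpha : R)
    (alpha_gt0 : 0 < alpha) (alpha_lt1 : alpha < 1) :
  exists C : R, 0 < C /\
    forall (u : R -> torus R -> R * R), in_Linf_holder alpha u ->
    forall (kappa : R) (x : torus R) (t : R),
      0 < kappa < 1 -> 0 <= t <= 1 ->
    forall (d : measure_display) (Omega : measurableType d)
      (P : probability Omega R) (F : R -> set (set Omega))
      (w : R -> Omega -> R * R) (X : R -> Omega -> torus R),
      is_filtration F -> is_brownian_motion P F w ->
      is_sde_solution P F w u kappa x X ->
      (torus_variance P (X t) <=
       C%:E * ((kappa * t)%:E +
               (Linf_holder_norm alpha u * t%:E) `^ (2 / (1 - alpha))))%E.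
Proof.
pose M := 24 * ((alpha / (1 - alpha)) ^+ 2 + 1).
have M0 : 0 <= M by rewrite mulr_ge0// addr_ge0// sqr_ge0.
pose K2 := 3 * (2 `^ (1 - alpha)^-1) ^+ 2 : R.
have K20 : 0 <= K2 by rewrite mulr_ge0// sqr_ge0.
(* [K2] and [M] come from the pathwise estimate; 65 is 32 for the mean of the noise term [B] plus 33
   for its value at the chosen sample, and the summand 1 ensures positivity. *)
exists (K2 + M * 65 + 1); split; first by rewrite ltr_wpDl// addr_ge0// mulr_ge0.
move=> u uH kappa x t /andP[k0 _] /andP[t0 t1] d Omega P F w X HF Hw [aX X0 cX sX].
have t01 : t \in `[0, 1] by rewrite in_itv/= t0.
have mXt : measurable_fun setT (X t) by exact: (measurable_fun_adapted HF aX).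
have mdist a : measurable_fun setT (fun om => (torus_dist (X t om) a ^+ 2)%:E).
  apply/measurable_EFinP; apply: measurable_funX.
  exact: (measurableT_comp (measurable_torus_dist a) mXt).
have [N [N0 NE uN]] := in_Linf_holder_ae uH.
rewrite NE -EFinM.
(* The time average divides by [t]. At time 0 the process is almost surely at [x], and [x] as centre
   gives variance zero. *)
have [t_eq0|t_neq0] := eqVneq t 0.
  apply: le_trans (torus_variance_le P x mXt) _.
  rewrite (ae_eq_integral (cst 0%E))//.
    rewrite integral0 lee_fin t_eq0 mulr0 add0r mulr_ge0 ?powR_ge0//.
    by rewrite addr_ge0// addr_ge0// mulr_ge0.
  by apply: filterS X0 => om + _; rewrite t_eq0 => ->; rewrite torus_distxx expr0n.
have {t_neq0}t0 : 0 < t by rewrite lt_neqAle eq_sym t_neq0.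
have [q [q0 cq mq qE qle]] := brownian_motion_sqr_modification HF Hw.
have qint om : lebesgue_measure.-integrable `[0, t] (EFin \o (q ^~ om)).
  by apply: within_itv_integrable; exact: continuous_subspaceT.
have [mA Ale] : measurable_fun setT
    (fun om => \int[lebesgue_measure]_(s in `[0%R, t]) (q s om)%:E)%E /\
    (\int[P]_om \int[lebesgue_measure]_(s in `[0%R, t]) (q s om)%:E <= (t * (16 * t))%:E)%E.
  apply: ge0_integral_time_average_le => // s; rewrite in_itv/= => /andP[s0 st].
  by apply: le_trans (qle s _) _; rewrite ?lee_fin ?in_itv/= ?s0 ?(le_trans st)// ler_pM2l.
(* [B] is the contribution of one sample's noise to the pathwise bound. The final value and the time
   average each have mean at most [16 * t]. *)
pose B om := q t om + t^-1 * \int[lebesgue_measure]_(s in `[0, t]) q s om.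
have BE om : (B om)%:E = ((q t om)%:E +
    (t^-1)%:E * \int[lebesgue_measure]_(s in `[0%R, t]) (q s om)%:E)%E.
  by rewrite /B EFinD EFinM fineK//; exact: (integrable_fin_num _ (qint om)).
have B0 om : 0 <= B om.
  rewrite addr_ge0// mulr_ge0 ?invr_ge0 ?(ltW t0)//.
  by apply: Rintegral_ge0.
have mBe : measurable_fun setT (EFin \o B).
  under [X in measurable_fun _ X]eq_fun do rewrite /= BE.
  by apply: emeasurable_funD; [exact/measurable_EFinP|exact: measurable_funeM].
have mB : measurable_fun setT B by exact/measurable_EFinP.
have EB : (\int[P]_om (B om)%:E <= (32 * t)%:E)%E.
  under eq_integral do rewrite BE.
  have I0 om : (0 <= \int[lebesgue_measure]_(s in `[0%R, t]) (q s om)%:E)%E.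
    by apply: integral_ge0 => s _; rewrite lee_fin.
  have ti : (0 <= (t^-1)%:E :> \bar R)%E by rewrite lee_fin invr_ge0 ltW.
  rewrite ge0_integralD//; last 4 first.
  - by move=> *; rewrite lee_fin.
  - exact/measurable_EFinP.
  - by move=> *; exact: mule_ge0.
  - exact: measurable_funeM.
  rewrite ge0_integralZl//.
  rewrite (_ : 32 * t = 16 * t + t^-1 * (t * (16 * t))); last by field; rewrite gt_eqF.
  by rewrite EFinD (EFinM t^-1 (t * (16 * t))); apply: leeD; [exact: qle|exact: lee_wpmul2l].
(* [Q] gathers the almost sure properties, so that a single sample can have all of them at every
   time of the unit interval. *)
pose Q om := [/\ {within `[0, 1], continuous (X ^~ om)},
  {within `[0, 1], continuous (w ^~ om)},
  forall s, s \in `[0, 1] -> q s om = enorm (w s om) ^+ 2 &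
  forall s, s \in `[0, 1] -> X s om = torus_add x (drift u X s om +
    (Num.sqrt (2 * kappa) * (w s om).1, Num.sqrt (2 * kappa) * (w s om).2))].
have Qae : {ae P, forall om, Q om}.
  have [_ _ cw _ _] := Hw.
  by apply: filterS3 (filterI cX cw) qE sX => om [? ?] ? ?.
(* Any constant above 32 would do, since some sample must come close to the mean or below it. *)
have [om0 [[cX0 cw0 qE0 sX0] Bom0]] : exists om, Q om /\ B om <= 33 * t.
  apply: ae_exists_le_mean mB B0 _ EB Qae; lra.
have path om : Q om -> torus_dist (X t om) (X t om0) ^+ 2 <=
    3 * ((2 * N * t) `^ (1 - alpha)^-1) ^+ 2 + M * kappa * (B om + B om0).
  move=> [cXo cwo qEo sXo].
  exact: (@torus_dist_sde_paths_le R alpha N kappa t u x (X ^~ om) (X ^~ om0)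
    (w ^~ om) (w ^~ om0) (q ^~ om) (q ^~ om0) alpha_gt0 alpha_lt1 N0 (ltW k0) t0 t1
    uH.1 uN).
(* Squaring doubles the exponent [1 / (1 - alpha)], and the power of 2 moves into [K2]. *)
have KE : 3 * ((2 * N * t) `^ (1 - alpha)^-1) ^+ 2 = K2 * (N * t) `^ (2 / (1 - alpha)).
  rewrite /K2 -mulrA powRM ?mulr_ge0 ?(ltW t0)// exprMn mulrA; congr (_ * _).
  by rewrite -powR_mulrn ?powR_ge0// -powRrM [_^-1 * _]mulrC.
set L := (N * t) `^ _ in KE *.
have L0 : 0 <= L by exact: powR_ge0.
apply: le_trans (torus_variance_le P (X t om0) mXt) _.
have kge0 := ltW k0; have Mk0 : 0 <= M * kappa by exact: mulr_ge0.
apply: (@le_trans _ _ (\int[P]_om ((K2 * L + M * kappa * B om0)%:E +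
    (M * kappa)%:E * (B om)%:E))%E).
  apply: ae_ge0_le_integral => //.
  - by move=> *; rewrite lee_fin sqr_ge0.
  - by move=> *; rewrite -EFinM -EFinD lee_fin; do ?apply: addr_ge0; apply: mulr_ge0.
  - by apply: emeasurable_funD => //; apply: measurable_funeM; exact: mBe.
  - by apply: filterS Qae => om Qom _; rewrite -EFinM -EFinD lee_fin;
      have := path om Qom; rewrite KE; lra.
rewrite ge0_integralD//; last 3 first.
- by move=> *; rewrite lee_fin; apply: addr_ge0; apply: mulr_ge0.
- by move=> *; rewrite -EFinM lee_fin; apply: mulr_ge0.
- apply: measurable_funeM; exact: mBe.
rewrite integral_cst//= probability_setT mule1 ge0_integralZl//; last first.
  by move=> *; rewrite lee_fin.
apply: (@le_trans _ _ ((K2 * L + M * kappa * (33 * t))%:E + (M * kappa)%:E * (32 * t)%:E)%E).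
  by apply: leeD; [rewrite lee_fin lerD2l ler_wpM2l|apply: lee_wpmul2l].
rewrite -EFinM -EFinD lee_fin.
have kt : 0 <= kappa * t by rewrite mulr_ge0// ltW.
have h1 : 0 <= K2 * (kappa * t) by exact: mulr_ge0.
have h2 : 0 <= M * L by exact: mulr_ge0.
(* The slack consists of the cross terms, since [C] multiplies both [kappa * t] and [L], and of the
   contribution of the summand 1. *)
rewrite -subr_ge0 (_ : _ - _ = K2 * (kappa * t) + 65 * (M * L) + kappa * t + L); last by ring.
by rewrite !addr_ge0// mulr_ge0.
Qed.
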